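(* Let $n\ge 1$ and let $p(x)=(x-x_1)(x-x_2)\cdots(x-x_n)$ with real roots $1\ge x_1>x_2>\cdots>x_n\ge -1$. Suppose that $p$ has the largest discriminant among all monic real polynomials of degree $n$ having $n$ distinct real roots in $[-1,1]$. Then $p$ satisfies the ordinary differential equation $$p''(x)=\frac{-n(n-1)}{1-x^2}\,p(x)$$ (for $x\ne\pm1$).
   Context: The discriminant of a monic polynomial $\prod_{i=1}^n(x-x_i)$ is $\prod_{1\le i<k\le n}(x_i-x_k)^2$ (equal to $1$ if $n=1$). *)

(* Defs.v *)
From mathcomp Require Import all_boot all_order all_algebra.
From mathcomp Require Import reals.
Set Implicit Arguments.
Unset Strict Implicit.
Unset Printing Implicit Defensive.
Import Order.TTheory GRing.Theory Num.Theory.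
Local Open Scope ring_scope.

(* A relation rather than a function, since the roots x_i must be produced.
   It is functional in [d]: the factorization determines the x_i up to order,
   and the product of squared differences does not depend on that order. *)
Definition has_discriminant (R : realType) (p : {poly R}) (d : R) : Prop :=
  exists n (x : 'I_n -> R),
    p = \prod_(i < n) ('X - (x i)%:P) /\
    d = \prod_(i < n) \prod_(k < n | (i < k)%N) (x i - x k) ^+ 2.

Definition monic_with_distinct_roots (R : realType) (n : nat) (p : {poly R})
    : Prop :=
  [/\ p \is monic, size p = n.+1 &
      exists s : seq R, [/\ size s = n, uniq s &
        forall z, z \in s -> root p z /\ -1 <= z <= 1]].

(* Every polynomial in the class splits, so it has a discriminant and the
   quantification over [dp] and [dq] is not vacuous. *)
Definition has_largest_discriminant (R : realType) (n : nat) (p : {poly R})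
    : Prop :=
  monic_with_distinct_roots n p /\
  forall (q : {poly R}) (dp dq : R), monic_with_distinct_roots n q ->
    has_discriminant p dp -> has_discriminant q dq -> dq <= dp.

(* Main.v *)
(** Fix the roots other than [x_i] and let [q = p / (X - x_i)].  As a function
    of the position [y] of the i-th root the discriminant is [C * q(y)^2] with
    [C > 0], so [q^2] is maximal over [[-1, 1]] at [x_i].  Hence, if [x_i] is
    interior, [0 = 2 q'(x_i) = p''(x_i)]; in all cases
    [(1 - x_i^2) p''(x_i) = 0].  The polynomial [(1 - X^2) p'' + n (n - 1) p]
    has degree less than [n], because its terms of degree [n] cancel, and
    vanishes at the [n] points [x_i], so it is zero. *)
Require Import Defs.
From mathcomp Require Import all_boot all_order all_algebra.
From mathcomp Require Import reals.
From mathcomp Require Import polyrcf ring lra.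
Set Implicit Arguments.
Unset Strict Implicit.
Unset Printing Implicit Defensive.
Import Order.TTheory GRing.Theory Num.Theory.
Local Open Scope ring_scope.

(** Isolates the factors that depend on the [i]-th root. By symmetry, the pairs [(j, i)] with
    [j < i] and the pairs [(i, k)] with [i < k] merge into one product over all [k != i]. *)
Lemma prod_lt_pairsD1 (R : comPzRingType) (n : nat) (F : 'I_n -> 'I_n -> R)
    (i : 'I_n) :
  (forall j k, F j k = F k j) ->
  \prod_(j < n) \prod_(k < n | (j < k)%N) F j k =
  \prod_(k < n | k != i) F i k *
  \prod_(j < n | j != i) \prod_(k < n | (j < k)%N && (k != i)) F j k.
Proof.
move=> Fsym; rewrite (bigD1 i) //=.
have row j : j != i -> \prod_(k < n | (j < k)%N) F j k =
    (if (j < i)%N then F i j else 1) *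
    \prod_(k < n | (j < k)%N && (k != i)) F j k.
  move=> _; case: ifP => ji; first by rewrite (bigD1 i) //= Fsym.
  rewrite mul1r; apply: eq_bigl => k.
  by case: eqP => [->|_]; rewrite ?ji ?andbT.
rewrite (eq_bigr _ row) big_split /= mulrA; congr (_ * _).
(* Row [i] is padded with ones so that it can be multiplied termwise with the factors [F i j],
   [j < i], extracted from the other rows. *)
have -> : \prod_(k < n | (i < k)%N) F i k =
    \prod_(k < n | k != i) (if (i < k)%N then F i k else 1).
  rewrite -big_mkcondr; apply: eq_bigl => k.
  by case: eqP => [->|_]; rewrite ?ltnn.
rewrite -big_split; apply: eq_bigr => k ki /=.
by case: ltngtP => [||/val_inj ik]; rewrite ?mulr1 ?mul1r // ik eqxx in ki *.
Qed.

(** Write [r = s * (X - a) + r(a)], so that [r'(a) = s(a)]. If [s(a)] were nonzero, [s] would keep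
    its sign near [a], and [r] would exceed [r(a)] on one side of [a]. *)
Lemma deriv_local_max (R : rcfType) (r : {poly R}) (a lo hi : R) :
  lo < a < hi -> (forall y, lo <= y <= hi -> r.[y] <= r.[a]) -> r^`().[a] = 0.
Proof.
move=> /andP[loa ahi] rmax.
have /factor_theorem[s rs] : root (r - (r.[a])%:P) a.
  by rewrite /root !hornerE subrr.
have rsE : r = s * ('X - a%:P) + (r.[a])%:P by rewrite -rs subrK.
have rE y : r.[y] = s.[y] * (y - a) + r.[a] by rewrite {1}rsE !hornerE.
have -> : r^`().[a] = s.[a] by rewrite rsE !derivE !hornerE; ring.
apply/eqP; apply: contraT => sa0.
(* The tolerance [|s(a)|] is exactly what prevents [s] from changing sign within distance [d] of
   [a]. *)
have [d d0 sd] := poly_cont a s (e := `|s.[a]|) ltac:(by rewrite normr_gt0).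
(* Halving [d] makes [h < d] strict; the other two bounds keep [a + h] and [a - h] inside
   [[lo, hi]]. *)
pose h := Num.min (d / 2) (Num.min (a - lo) (hi - a)).
have h0 : 0 < h by rewrite !lt_min; lra.
have [hd hlo hhi] : [/\ h < d, h <= a - lo & h <= hi - a].
  by rewrite /h !ge_min !gt_min !lexx ?orbT; split=> //; apply/orP; left; lra.
have [|sa] : 0 < s.[a] \/ s.[a] < 0 by move: sa0; rewrite neq_lt => /orP[]; auto.
- move=> sa; have := sd (a + h); rewrite addrAC subrr add0r (gtr0_norm h0).
  rewrite (gtr0_norm sa) ltr_norml => /(_ hd) /andP[sh _].
  have := rmax (a + h); rewrite rE; nra.
- have := sd (a - h); rewrite addrAC subrr add0r normrN (gtr0_norm h0).
  rewrite (ltr0_norm sa) ltr_norml => /(_ hd) /andP[_ sh].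
  have := rmax (a - h); rewrite rE; nra.
Qed.

Lemma size_prod_ord_XsubC (R : idomainType) (n : nat) (x : 'I_n -> R) :
  size (\prod_(i < n) ('X - (x i)%:P)) = n.+1.
Proof. by rewrite -big_enum size_prod_XsubC size_enum_ord. Qed.

Lemma monic_with_distinct_roots_prod (R : realType) (n : nat) (x : 'I_n -> R) :
  injective x -> (forall i, -1 <= x i <= 1) ->
  monic_with_distinct_roots n (\prod_(i < n) ('X - (x i)%:P)).
Proof.
move=> xinj xbnd; split; first exact: monic_prod_XsubC.
  exact: size_prod_ord_XsubC.
exists (map x (enum 'I_n)); split.
- by rewrite size_map size_enum_ord.
- by rewrite map_inj_uniq ?enum_uniq.
- move=> z /mapP[i _ ->]; split=> //.
  by rewrite /root horner_prod (bigD1 i) //= !hornerE subrr mul0r.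
Qed.

(** Moving the [i]-th root to [y] changes only the pairs containing [i]. The remaining pairs
    contribute the same positive constant to both discriminants, and it cancels. *)
Lemma largest_discriminant_cofactor_max (R : realType) (n : nat)
    (x : 'I_n -> R) (i : 'I_n) (y : R) :
  injective x -> (forall j, -1 <= x j <= 1) ->
  has_largest_discriminant n (\prod_(j < n) ('X - (x j)%:P)) ->
  -1 <= y <= 1 ->
  \prod_(j < n | j != i) (y - x j) ^+ 2 <=
  \prod_(j < n | j != i) (x i - x j) ^+ 2.
Proof.
move=> xinj xbnd [_ xmax] ybnd.
(* If [y] hits another root, the modified polynomial has a double root and maximality says nothing
   about it, but then the left side is 0. *)
have [/existsP[k /andP[ki /eqP yk]]|/existsPn ynew] :=
  boolP [exists k, (k != i) && (y == x k)].
  rewrite [leLHS](bigD1 k) //= yk subrr expr0n mul0r.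
  by apply: prodr_ge0 => j _; exact: sqr_ge0.
pose z j := if j == i then y else x j.
have yx k : k != i -> y <> x k.
  by move=> ki yk; have := ynew k; rewrite ki yk eqxx.
have zinj : injective z.
  move=> j k; rewrite /z; case: eqP => [->|/eqP ji]; case: eqP => [->|/eqP ki] //.
  - by move/(yx _ ki).
  - by move/esym/(yx _ ji).
  - exact: xinj.
have zbnd j : -1 <= z j <= 1 by rewrite /z; case: ifP.
have := xmax _ _ _ (monic_with_distinct_roots_prod zinj zbnd)
  (ex_intro _ n (ex_intro _ x (conj erefl erefl)))
  (ex_intro _ n (ex_intro _ z (conj erefl erefl))).
have sqrC (w : 'I_n -> R) j k : (w j - w k) ^+ 2 = (w k - w j) ^+ 2 by ring.
rewrite (prod_lt_pairsD1 i (sqrC z)) (prod_lt_pairsD1 i (sqrC x)).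
have -> : \prod_(k < n | k != i) (z i - z k) ^+ 2 =
    \prod_(k < n | k != i) (y - x k) ^+ 2.
  by apply: eq_bigr => k /negbTE ki; rewrite /z eqxx ki.
have -> : \prod_(j < n | j != i)
      \prod_(k < n | (j < k)%N && (k != i)) (z j - z k) ^+ 2 =
    \prod_(j < n | j != i)
      \prod_(k < n | (j < k)%N && (k != i)) (x j - x k) ^+ 2.
  apply: eq_bigr => j /negbTE ji; apply: eq_bigr => k /andP[_ /negbTE ki].
  by rewrite /z ji ki.
rewrite ler_pM2r //; apply: prodr_gt0 => j _; apply: prodr_gt0 => k /andP[jk _].
rewrite exprn_even_gt0 //= subr_eq0; apply: contraTneq jk => /xinj ->.
by rewrite ltnn.
Qed.

Lemma largest_discriminant_deriv2_root (R : realType) (n : nat)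
    (x : 'I_n -> R) (i : 'I_n) :
  injective x -> (forall j, -1 <= x j <= 1) ->
  has_largest_discriminant n (\prod_(j < n) ('X - (x j)%:P)) ->
  (1 - x i ^+ 2) * (\prod_(j < n) ('X - (x j)%:P))^`(2).[x i] = 0.
Proof.
move=> xinj xbnd xmax.
have [x1|x1] := eqVneq (x i) 1; first by rewrite x1 expr1n subrr mul0r.
have [xN1|xN1] := eqVneq (x i) (-1).
  by rewrite xN1 sqrrN expr1n subrr mul0r.
pose q := \prod_(j < n | j != i) ('X - (x j)%:P).
have q2E y : (q ^+ 2).[y] = \prod_(j < n | j != i) (y - x j) ^+ 2.
  rewrite hornerE horner_prod -prodrXl.
  by apply: eq_bigr => j _; rewrite !hornerE.
have xi : -1 < x i < 1 by have := xbnd i; rewrite !lt_neqAle x1 eq_sym xN1.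
have q2max y : -1 <= y <= 1 -> (q ^+ 2).[y] <= (q ^+ 2).[x i].
  by move=> ybnd; rewrite !q2E; apply: largest_discriminant_cofactor_max.
have qx0 : q.[x i] != 0.
  rewrite horner_prod; apply/prodf_neq0 => j ji.
  by rewrite !hornerE subr_eq0; apply: contraNneq ji => /xinj ->.
(* The derivative of [q ^+ 2] is [2 q q'], and [q] does not vanish at [x i] because the roots are
   distinct. *)
have q'0 : q^`().[x i] = 0.
  have := deriv_local_max xi q2max.
  rewrite expr2 derivM !hornerE => /eqP.
  by rewrite mulrC -mulr2n mulrn_eq0 /= mulf_eq0 (negbTE qx0) => /eqP.
(* From [p = (X - x_i) q] one gets [p'' = 2 q' + (X - x_i) q'']; both terms vanish at [x i]. *)
rewrite (bigD1 i) //= -/q !derivE !hornerE q'0.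
by rewrite /= subrr oppr0 !mul0r !mulr0 !addr0 mulr0.
Qed.

(** The coefficient at [j] is [(j+2)(j+1) p_(j+2) - j(j-1) p_j + n(n-1) p_j]. For [j > n] every term
    is zero; for [j = n] the first is zero and the other two cancel. *)
Lemma size_ode_poly (R : comNzRingType) (n : nat) (p : {poly R}) :
  (size p <= n.+1)%N ->
  (size ((1 - 'X^2) * p^`(2) + (n%:R * (n%:R - 1)) *: p)%R <= n)%N.
Proof.
move=> sp; apply/leq_sizeP => j nj.
have p0 k : (n < k)%N -> p`_k = 0.
  by move=> nk; apply: nth_default; exact: leq_trans nk.
rewrite coefD coefZ mulrBl mul1r coefB coefXnM !coef_derivn.
rewrite (p0 (2 + j)%N) ?mul0rn ?sub0r; last by rewrite ltnS ltnW.
move: nj; rewrite leq_eqVlt => /predU1P[<-|nj]; last first.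
  rewrite (p0 j) // mulr0 addr0; case: ifP => [_|/negbT]; first exact: oppr0.
  by rewrite -leqNgt => j2; rewrite subnKC // (p0 j) // mul0rn oppr0.
(* For [n = 0] and [n = 1] the product with ['X^2] has no coefficient at [n], and [n (n - 1)] is 0
   as well. *)
case: n {sp p0} => [|[|n]] /=; rewrite ?mul0r ?subrr ?mulr0 ?mul0r ?oppr0 ?addr0 //.
rewrite !subSS subn0 add2n !ffactnS ffactn0 muln1 /= -[_`_ _ *+ _]mulr_natl natrM.
have -> : n.+2%:R - 1 = n.+1%:R :> R by rewrite -natr1 addrK.
exact: addNr.
Qed.

Theorem theorem4p4 (R : realType) (n : nat) (hn : (1 <= n)%N)
    (x : 'I_n -> R) (p : {poly R})
    (hp : p = \prod_(i < n) ('X - (x i)%:P))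
    (hdec : forall i j : 'I_n, (i < j)%N -> x j < x i)
    (hbnd : forall i : 'I_n, -1 <= x i <= 1)
    (hmax : has_largest_discriminant n p) :
  forall t : R, t != 1 -> t != -1 ->
    p^`(2).[t] = - (n%:R * (n%:R - 1)) / (1 - t ^+ 2) * p.[t].
Proof.
have xinj : injective x.
  by move=> i j xij; apply/val_inj; case: (ltngtP i j) => // /hdec; rewrite xij ltxx.
pose P := (1 - 'X^2) * p^`(2) + (n%:R * (n%:R - 1)) *: p.
have P0 : P = 0.
  apply: (@roots_geq_poly_eq0 _ _ (map x (enum 'I_n))).
  - apply/allP => _ /mapP[i _ ->]; rewrite /root /P !hornerE.
    have -> : p.[x i] = 0.
      by rewrite hp horner_prod (bigD1 i) //= !hornerE subrr mul0r.
    rewrite mulr0 addr0 hp largest_discriminant_deriv2_root //.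
    by rewrite -hp.
  - by rewrite map_inj_uniq ?enum_uniq.
  - rewrite size_map size_enum_ord; apply: size_ode_poly.
    by rewrite hp size_prod_ord_XsubC.
move=> t t1 tN1.
have t2 : 1 - t ^+ 2 != 0.
  by rewrite subr_eq0 eq_sym sqrf_eq1 negb_or t1.
have := congr1 (horner^~ t) P0; rewrite /P !hornerE => Pt.
apply: (mulfI t2); rewrite -[LHS]opprK (addr0_eq Pt).
by field.
Qed.
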